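(* Let $X$ be a complex Hilbert space and let $$H=\begin{pmatrix} A & B\\ C & -A^*\end{pmatrix}$$ be a Hamiltonian operator matrix on $X\times X$. Suppose that $\mathcal{D}(H)=\mathcal{D}(A)\times\mathcal{D}(A^* )$ and that $\rho(A)\neq\emptyset$. Then the following statements are equivalent: (1) $H$ is symplectic self-adjoint; (2) $A^*+\lambda+C(A-\lambda)^{-1}B=\bigl(A+\overline{\lambda}+B(A^*-\overline{\lambda})^{-1}C\bigr)^*$ for some (and hence for all) $\lambda\in\rho(A)$; (3) $A+\overline{\lambda}+B(A^*-\overline{\lambda})^{-1}C=\bigl(A^*+\lambda+C(A-\lambda)^{-1}B\bigr)^*$ for some (and hence for all) $\lambda\in\rho(A)$.
   Context: All operators are linear and possibly unbounded; $\mathcal{D}(T)$ denotes the domain and $\rho(T)$ the resolvent set of $T$. Sums and products of operators have their natural (maximal) domains, and equality of operators includes equality of domains. Block operator matrix: for operators $A,B,C,D$ in $X$, the matrix $H=\begin{pmatrix} A&B\\ C&D\end{pmatrix}$ denotes the operator on $X\times X$ with domain $\mathcal{D}(H)=(\mathcal{D}(A)\cap\mathcal{D}(C))\times(\mathcal{D}(B)\cap\mathcal{D}(D))$ and action $H(x_1,x_2)^t=(Ax_1+Bx_2,\;Cx_1+Dx_2)^t$. Hamiltonian operator matrix: a block operator matrix $H=\begin{pmatrix} A&B\\ C&-A^*\end{pmatrix}$ on $X\times X$, $X$ a complex Hilbert space, where $A,B,C$ are closed densely defined operators in $X$, $B$ and $C$ are self-adjoint, and $H$ is densely defined. Let $J=\begin{pmatrix}0&I\\-I&0\end{pmatrix}$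 on $X\times X$. A Hamiltonian operator matrix $H$ is called symplectic self-adjoint if $JH=(JH)^*$. *)

(* Defs.v *)
From HB Require Import structures.
From mathcomp Require Import all_boot all_order all_algebra.
From mathcomp Require Import complex.
From mathcomp Require Import all_classical all_reals all_analysis.
Import Order.TTheory GRing.Theory Num.Theory.
Import numFieldNormedType.Exports.

Set Implicit Arguments.
Unset Strict Implicit.
Unset Printing Implicit Defensive.

Local Open Scope classical_set_scope.
Local Open Scope ring_scope.

(* An unbounded operator from U to V is identified with its graph, a subset of
   U * V. Its domain is the first projection T.`1, so that Leibniz equality of
   graphs is equality of operators including equality of domains. *)

Section Operators.
Context {K : pzRingType}.
Implicit Types U V W : lmodType K.

Definition linear_operator U V (T : set (U * V)) : Prop :=
  [/\ T 0,
      forall (a : K) p q, T p -> T q -> T (a *: p + q)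
    & forall x y z, T (x, y) -> T (x, z) -> y = z].

Definition total_op U V (f : U -> V) : set (U * V) :=
  [set p | p.2 = f p.1].

(* a times the identity, defined everywhere *)
Definition scalar_op U (a : K) : set (U * U) := total_op ( *:%R a).

Definition add_op U V (S T : set (U * V)) : set (U * V) :=
  [set p | exists y z, [/\ S (p.1, y), T (p.1, z) & p.2 = y + z]].

Definition opp_op U V (T : set (U * V)) : set (U * V) :=
  [set p | T (p.1, - p.2)].

(* the library's S \; T applies T first *)
Definition mul_op U V W (S : set (V * W)) (T : set (U * V)) : set (U * W) :=
  (S \; T)%relation.

Definition inv_op U V (T : set (U * V)) : set (V * U) := (T^-1)%relation.

Definition block_op U (A B C D : set (U * U)) : set ((U * U) * (U * U)) :=
  [set p | exists a b c d,
    [/\ A (p.1.1, a), B (p.1.2, b), C (p.1.1, c), D (p.1.2, d)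
      & p.2 = (a + b, c + d)]].

End Operators.

Declare Scope op_scope.
Delimit Scope op_scope with OP.
Notation "a %:I" := (scalar_op a) (at level 2, format "a %:I") : op_scope.
Notation "S + T" := (add_op S T) : op_scope.
Notation "- T" := (opp_op T) : op_scope.
Notation "S - T" := (add_op S (opp_op T)) : op_scope.
Notation "S * T" := (mul_op S T) : op_scope.
Notation "T ^-1" := (inv_op T) : op_scope.

Definition symplectic_J {K : pzRingType} {U : lmodType K} :
    set ((U * U) * (U * U)) :=
  block_op (0 %:I)%OP (1 %:I)%OP (- 1 %:I)%OP (0 %:I)%OP.

(* The inner product of the Hilbert space sum X (+) X. It cannot be recovered
   from the norm of the library's normed module X * X, which is the max norm
   (it induces the same topology). *)
Section PairDot.
Context {K : numClosedFieldType} {U : lmodType K}.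
Variable f : {dot U for Num.conj}.

Definition pair_dot (u v : U * U) : K := f u.1 v.1 + f u.2 v.2.

Let pair_dot_bilinear :
  bilinear_for ( *%R : GRing.Scale.law K K) (Num.conj \; *%R) pair_dot.
Proof.
split=> [v|u] a x y; rewrite /pair_dot /=.
  by rewrite !linearPl /= mulrDr addrACA.
by rewrite !linearP /= mulrDr addrACA.
Qed.

HB.instance Definition _ :=
  bilinear_isBilinear.Build K (U * U)%type (U * U)%type K
    *%R (Num.conj \; *%R) pair_dot pair_dot_bilinear.

Let pair_dot_hermitian u v : pair_dot u v = (-1) ^+ false * (pair_dot v u)^*.
Proof.
rewrite /pair_dot rmorphD mulrDr.
by rewrite -!hermitian_subproof.
Qed.

HB.instance Definition _ :=
  isHermitianSesquilinear.Build K (U * U)%type false Num.conj pair_dot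
    pair_dot_hermitian.

Let pair_dot_gt0 (u : U * U) : u != 0 -> 0 < pair_dot u u.
Proof.
have f_ge0 x : 0 <= f x x.
  by have [->|/neq0_dnorm_gt0/ltW//] := eqVneq x 0; rewrite linear0.
case: u => x y; rewrite -pair_eqE negb_and /pair_dot /=.
by case/orP=> /(@neq0_dnorm_gt0 _ _ _ f) h; [apply: ltr_wpDr|apply: ltr_wpDl].
Qed.

HB.instance Definition _ :=
  isDotProduct.Build K (U * U)%type pair_dot pair_dot_gt0.

End PairDot.

(* For a linear operator T this graph is single-valued exactly when T is densely
   defined. *)
Definition adjoint {K : numClosedFieldType} {U : lmodType K}
    (f : {dot U for Num.conj}) (T : set (U * U)) : set (U * U) :=
  [set p | forall x y, T (x, y) -> f y p.1 = f x p.2].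

Definition resolvent_set {K : numClosedFieldType} {X : normedModType K}
    (T : set (X * X)) : set K :=
  [set l | exists2 S : {linear X -> X},
     exists M : K, forall x, `|S x| <= M * `|x|
   & ((T - l %:I)^-1)%OP = total_op S].

Definition closed_densely_defined {K : numFieldType} {X : normedModType K}
    (T : set (X * X)) : Prop :=
  [/\ linear_operator T, closed T & dense T.`1].

Definition hamiltonian_matrix {K : numClosedFieldType} {X : normedModType K}
    (f : {dot X for Num.conj}) (A B C : set (X * X)) : set ((X * X) * (X * X)) :=
  block_op A B C (- adjoint f A)%OP.

Definition is_hamiltonian {K : numClosedFieldType} {X : normedModType K}
    (f : {dot X for Num.conj}) (A B C : set (X * X)) : Prop :=
  [/\ [/\ closed_densely_defined A, closed_densely_defined B
        & closed_densely_defined C],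
      B = adjoint f B, C = adjoint f C
    & dense (hamiltonian_matrix f A B C).`1].

Definition symplectic_self_adjoint {K : numClosedFieldType} {U : lmodType K}
    (f : {dot U for Num.conj}) (H : set ((U * U) * (U * U))) : Prop :=
  (symplectic_J * H)%OP = adjoint (pair_dot f) (symplectic_J * H)%OP.

(* Main.v *)
Require Import Defs.
From mathcomp Require Import all_boot all_order all_algebra.
From mathcomp Require Import complex.
From mathcomp Require Import all_classical all_reals all_analysis.
From mathcomp Require Import ring lra.
Import Order.TTheory GRing.Theory Num.Theory.
Import numFieldNormedType.Exports.

(** For [l] in the resolvent set of [A], put [S = (A - l)^-1]. Its bounded
adjoint [S'] is [(A^* - l^* )^-1], so that [A] is the adjoint of [A^*] and the
two Schur complements
  [S1 = A^* + l + C S B]   and   [S2 = A + l^* + B S' C]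
have domains [D(A^* )] and [D(A)], because [D(A)] lies in [D(C)] and [D(A^* )]
in [D(B)].

The operator [JH = (C, - A^*; - A, - B)] is always symmetric, and its domain
[D(A) * D(A^* )] is dense. So [JH] is self-adjoint exactly when the domain of
its adjoint is no larger than [D(A) * D(A^* )]: this is
[adjoint_domain_inclusion], and [symplectic_self_adjointP] is the equivalence.

[schur_adjointP] shows that this domain inclusion is also equivalent to
[S2 = S1^*]. Both are ways to describe the adjoint of [J(H - l)]: the change of
variable [x = x' - S B y] turns [J(H - l)] into the triangular matrix with
entries [C], [- S1], [- (A - l)], whose lower left entry is invertible. Hence
[(u, v)] is in [D((JH)^* )] iff [u] is in [D(S1^* )] and in [D((C S)^* )], the
component [v] being then determined up to an element of [D(A^* )] by
[(C S)^* u]. If [S1^* = S2], then [u] is in [D(A)], hence in [D(C)], where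
[(C S)^* u = S' C u] is in [D(A^* )]. Conversely, each [u] in [D(S1^* )] has to
be completed to a pair [(u, v)], that is, [(C S)^*] has to be defined
everywhere. It is, by [Hellinger_Toeplitz]: [C S] is defined on the whole space
and has the formal adjoint [S' C] on the dense set [D(C)].

The domain inclusion is invariant under the exchange of [A, B, l] with
[A^*, C, l^*], up to the substitution [(u, v) |-> (v, - u)], and this exchange
swaps [S1] and [S2]. So it is equivalent to [S1 = S2^*] too. As it does not
mention [l], the equations for one [l] and for all [l] are equivalent.

The Hilbert space facts used are Riesz representation ([Riesz]), which gives
the adjoint of a bounded operator, and the uniform boundedness principle
([weakly_bounded]), from which [Hellinger_Toeplitz] follows. *)

Set Implicit Arguments.
Unset Strict Implicit.
Unset Printing Implicit Defensive.

Local Open Scope classical_set_scope.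
Local Open Scope ring_scope.

(** * Density, norms and completeness *)

Lemma subset_dense (T : topologicalType) (D D' : set T) :
  D `<=` D' -> dense D -> dense D'.
Proof.
by move=> sDD' dD O O0 oO; have [x [Ox /sDD' D'x]] := dD O O0 oO; exists x.
Qed.

(** The norm with values in [R] rather than [R[i]], whose order is only partial:
infima and linear arithmetic need a total order. *)
Definition rnorm {R : realType} {V : normedZmodType R[i]} (x : V) : R :=
  complex.Re `|x|.

Arguments rnorm : simpl never.

Section RealNorm.
Context {R : realType}.
Implicit Types V : normedZmodType R[i].

Lemma rnormE V (x : V) : (rnorm x)%:C%C = `|x|.
Proof. by rewrite RRe_real ?normr_real. Qed.

Lemma rnorm_ge0 V (x : V) : 0 <= rnorm x.
Proof. by rewrite -lecR rnormE normr_ge0. Qed.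

Lemma rnorm0 V : rnorm (0 : V) = 0.
Proof. by rewrite /rnorm normr0. Qed.

Lemma rnormN V (x : V) : rnorm (- x) = rnorm x.
Proof. by rewrite /rnorm normrN. Qed.

Lemma rdistC V (x y : V) : rnorm (x - y) = rnorm (y - x).
Proof. by rewrite -rnormN opprB. Qed.

Lemma ler_rnormD V (x y : V) : rnorm (x + y) <= rnorm x + rnorm y.
Proof. by rewrite -lecR rmorphD /= !rnormE ler_normD. Qed.

Lemma ler_rdistD V (x y z : V) : rnorm (x - z) <= rnorm (x - y) + rnorm (y - z).
Proof. by rewrite -lecR rmorphD /= !rnormE ler_distD. Qed.

Lemma rnorm_eq0 V (x : V) : (rnorm x == 0) = (x == 0).
Proof. by rewrite -(inj_eq (@complexI R)) rnormE normr_eq0. Qed.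

Lemma rnormM (z z' : R[i]) : rnorm (z * z') = rnorm z * rnorm z'.
Proof. by apply: (@complexI R); rewrite rmorphM /= !rnormE normrM. Qed.

Lemma rnormZ {X : normedModType R[i]} (a : R[i]) (x : X) :
  rnorm (a *: x) = rnorm a * rnorm x.
Proof. by apply: (@complexI R); rewrite rmorphM /= !rnormE normrZ. Qed.

Lemma rnormC (r : R) : rnorm r%:C%C = `|r|.
Proof. by rewrite /rnorm normc_def /= expr0n addr0 sqrtr_sqr. Qed.

Lemma ler_Re_rnorm (z : R[i]) : complex.Re z <= rnorm z.
Proof.
rewrite (le_trans (ler_norm _))// -lecR rnormE; exact: normc_ge_Re.
Qed.

Lemma Re_realM (r : R) (z : R[i]) : complex.Re (r%:C%C * z) = r * complex.Re z.
Proof. by case: z => a b /=; rewrite mul0r subr0. Qed.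

Lemma ReD (z z' : R[i]) : complex.Re (z + z') = complex.Re z + complex.Re z'.
Proof. by case: z z' => [a b] [a' b']. Qed.

Lemma ReN (z : R[i]) : complex.Re (- z) = - complex.Re z.
Proof. by case: z. Qed.

Lemma Re_conjC (z : R[i]) : complex.Re z^* = complex.Re z.
Proof. by apply: (@complexI R); rewrite !complexRe Re_conj. Qed.

Lemma eq0_small_multiple V (x : V) (K : R) :
  (forall e : R, 0 < e -> rnorm x <= e * K) -> x = 0.
Proof.
move=> h; apply/eqP; rewrite -rnorm_eq0; apply/negPn/negP => nz.
have xgt0 : 0 < rnorm x by rewrite lt_def nz rnorm_ge0.
have Kgt0 : 0 < 2 * (`|K| + 1) by have := normr_ge0 K; lra.
have := h (rnorm x / (2 * (`|K| + 1))) (divr_gt0 xgt0 Kgt0).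
apply/negP; rewrite -ltNge -mulrA -[X in _ < X]mulr1 ltr_pM2l//.
rewrite mulrC ltr_pdivrMr// mul1r; have := ler_norm K; have := normr_ge0 K; lra.
Qed.

Lemma harmonic_small (e : R) : 0 < e -> exists n, n.+1%:R^-1 < e.
Proof.
move=> e0; exists (Num.truncn e^-1).
by rewrite -ltf_pV2 ?posrE ?invr_gt0// invrK truncnS_gt.
Qed.

(** Completeness in terms of real epsilons. Comparing late terms
with the single term [u n] saves an index in the estimates. *)
Lemma complete_seq (X : completeNormedModType R[i]) (u : nat -> X) :
    (forall e : R, 0 < e ->
      exists n, forall m, (n <= m)%N -> rnorm (u n - u m) < e) ->
  exists l, forall e : R, 0 < e ->
    exists n, forall m, (n <= m)%N -> rnorm (l - u m) < e.
Proof.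
move=> cu.
have : cvg (u @ \oo).
  apply: cauchy_cvg; apply: cauchy_exP => e e0.
  have eC : (complex.Re e)%:C%C = e by rewrite RRe_real ?gtr0_real.
  have e0' : 0 < complex.Re e by rewrite -ltcR eC.
  have [n hn] := cu _ e0'; exists (u n); exists n => // m /= nm.
  by rewrite -ball_normE /= -rnormE -eC ltcR hn.
case/cvg_ex => l /cvgrPdist_lt hl; exists l => e e0.
have e0' : 0 < e%:C%C by rewrite ltcR.
have [n _ hn] := hl _ e0'; exists n => m nm.
by rewrite -ltcR rnormE; exact: hn.
Qed.

Lemma dense_approx (X : normedModType R[i]) (S : set X) : dense S ->
  forall (x : X) (e : R), 0 < e -> exists2 y, S y & rnorm (x - y) < e.
Proof.
move=> dS x e e0.
have e0' : 0 < e%:C%C by rewrite ltcR.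
have [|y [xy Sy]] := dS (ball x e%:C%C) _ (ball_open _ _).
  by exists x; exact: ballxx.
by exists y => //; move: xy; rewrite -ball_normE /= -rnormE ltcR.
Qed.

End RealNorm.

(** * Hilbert spaces *)

Section Hilbert.
Context {R : realType} {X : completeNormedModType R[i]}.
Variable dot : {dot X for Num.conj}.
Hypothesis dot_norm : forall x : X, dot x x = `|x| ^+ 2.
Implicit Types (x y u v w s t : X) (e r c : R).

Lemma dotC x y : dot x y = (dot y x)^*.
Proof. by rewrite (hermC dot) mul1r. Qed.

Lemma dotDl x y z : dot (x + y) z = dot x z + dot y z.
Proof. exact: linearDl. Qed.

Lemma dotDr x y z : dot x (y + z) = dot x y + dot x z.
Proof. exact: linearDr. Qed.

Lemma dotNl x y : dot (- x) y = - dot x y.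
Proof. exact: linearNl. Qed.

Lemma dotNr x y : dot x (- y) = - dot x y.
Proof. exact: linearNr. Qed.

Definition dot_addE := (dotDl, dotDr, dotNl, dotNr).

Lemma dotZl a x y : dot (a *: x) y = a * dot x y.
Proof. by rewrite linearZl_LR. Qed.

Lemma dotZr a x y : dot x (a *: y) = a^* * dot x y.
Proof. by rewrite linearZr_LR. Qed.

Lemma sqr_rnorm x : rnorm x ^+ 2 = complex.Re (dot x x).
Proof. by rewrite dot_norm -rnormE -rmorphXn. Qed.

Lemma sqr_rnormD x y :
  rnorm (x + y) ^+ 2 = rnorm x ^+ 2 + rnorm y ^+ 2 + 2 * complex.Re (dot x y).
Proof.
rewrite !sqr_rnorm linearDl/= !linearDr/= (dotC y x) !ReD Re_conjC.
by ring.
Qed.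

Lemma parallelogram x y :
  rnorm (x - y) ^+ 2 = 2 * rnorm x ^+ 2 + 2 * rnorm y ^+ 2 - rnorm (x + y) ^+ 2.
Proof. by rewrite !sqr_rnormD linearNr/= ReN rnormN; ring. Qed.

(** Expand [0 <= <w, w>] for [w = <y, y> x - <x, y> y]. *)
Lemma dot_CauchySchwarz x y : rnorm (dot x y) <= rnorm x * rnorm y.
Proof.
have [->|y0] := eqVneq y 0.
  by rewrite linear0r !rnorm0 mulr0.
rewrite -lecR rmorphM/= !rnormE.
rewrite -(@ler_pXn2r _ 2)// ?nnegrE ?mulr_ge0// exprMn -!dot_norm.
set c := dot x y; set d := dot y y.
have d0 : 0 < d by rewrite dnorm_gt0.
have dR : d^* = d by apply/CrealP; rewrite gtr0_real.
have := dnorm_ge0 dot (d *: x - c *: y).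
rewrite linearBl/= !linearBr/= !dotZl !dotZr -/c -/d dR (dotC y x) -/c.
rewrite -[_ - _ - _]/(_ - _ - _).
have -> : d * (d * dot x x) - d * (c^* * c) - (c * (d * c^*) - c * (c^* * d)) =
          d * (dot x x * d - `|c| ^+ 2) by rewrite normCK; ring.
by rewrite pmulr_rge0// subr_ge0.
Qed.

Lemma dense_dot_eq (S : set X) u v : dense S ->
  (forall x, S x -> dot x u = dot x v) -> u = v.
Proof.
move=> dS h; apply/eqP; rewrite -subr_eq0; apply/eqP.
apply: (@eq0_small_multiple _ _ _ 1) => e e0; rewrite mulr1.
have [y Sy ye] := dense_approx dS (u - v) e0.
have [->|n0] := eqVneq (u - v) 0; first by rewrite rnorm0 ltW.
have N0 : 0 < rnorm (u - v) by rewrite lt_def rnorm_eq0 n0 rnorm_ge0.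
rewrite -(ler_pM2r N0) -expr2 sqr_rnorm.
rewrite -{1}(subrK y (u - v)) linearDl/= [dot y _]linearBr/= h// subrr addr0.
rewrite (le_trans (ler_Re_rnorm _))// (le_trans (dot_CauchySchwarz _ _))//.
by rewrite ler_pM2r// ltW.
Qed.

Lemma dot_eq u v : (forall x, dot x u = dot x v) -> u = v.
Proof.
move=> h; apply: (@dense_dot_eq setT) => // O [x Ox] _; exists x; split => //.
Qed.

(** The functional [J x = |x|^2 - 2 Re (phi x)] is bounded below by [- M^2]. By
the parallelogram identity, near-minimisers of [J] are close to each other, so a
minimising sequence converges. Its limit [w] satisfies [Re (phi x) = Re <x, w>],
by variation of [J] along [x]; replacing [x] with [i x] gives the imaginary
parts. *)
Lemma Riesz (phi : X -> R[i]) (M : R) :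
    (forall a x y, phi (a *: x + y) = a * phi x + phi y) ->
    (forall x, rnorm (phi x) <= M * rnorm x) ->
  exists w, forall x, phi x = dot x w.
Proof.
move=> lphi bphi.
have phi0 : phi 0 = 0.
  have := lphi 1 0 0; rewrite scale1r addr0 mul1r => /eqP.
  by rewrite -subr_eq0 opprD addNKr oppr_eq0 => /eqP.
have phiD x y : phi (x + y) = phi x + phi y.
  by rewrite -[x]scale1r lphi mul1r scale1r.
have phiZ a x : phi (a *: x) = a * phi x.
  by rewrite -[a *: x]addr0 lphi phi0 addr0.
pose J x := rnorm x ^+ 2 - 2 * complex.Re (phi x).
have Jlb : lbound (range J) (- M ^+ 2).
  move=> _ [x _ <-]; rewrite /J.
  have := le_trans (ler_Re_rnorm _) (bphi x); have := sqr_ge0 (M - rnorm x).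
  by rewrite sqrrB; lra.
have Jinf : has_inf (range J) by split; [exists (J 0), 0 | exists (- M ^+ 2)].
have [m mJ m_approx] : exists2 m : R, forall x, m <= J x
    & forall e, 0 < e -> exists x, J x <= m + e.
  exists (inf (range J)) => [x|e /inf_adherent-/(_ _ Jinf)[_ [x _ <-] xm]].
    by apply: ge_inf; [exists (- M ^+ 2) | exists x].
  by exists x; rewrite ltW.
(* Lower bound for J at the midpoint of x and y. *)
have near_minimisers_close x y (d : R) : 0 < d ->
    J x <= m + d ^+ 2 -> J y <= m + d ^+ 2 ->
    rnorm (x - y) <= 2 * d.
  move=> d0 Jx Jy; rewrite -(@ler_pXn2r _ 2)// ?nnegrE ?rnorm_ge0//; last lra.
  rewrite parallelogram.
  have := mJ ((2^-1 : R)%:C%C *: (x + y)); move: Jx Jy; rewrite /J.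
  rewrite phiZ phiD Re_realM ReD rnormZ rnormC ger0_norm// !exprMn exprVn.
  move: (rnorm (x + y) ^+ 2) (rnorm x ^+ 2) (rnorm y ^+ 2) (d ^+ 2) => *; lra.
(* J (x + c t) is quadratic in the real number c, and bounded below by J x - d^2;
   this is a bound on the linear coefficient. *)
have variation x t (d : R) : 0 < d -> J x <= m + d ^+ 2 ->
    `|complex.Re (dot t x) - complex.Re (phi t)| <= d * rnorm t.
  move=> d0 Jx; set b := _ - _.
  have Jc c : 0 <= d ^+ 2 + 2 * c * b + c ^+ 2 * rnorm t ^+ 2.
    have := mJ (x + c%:C%C *: t); move: Jx; rewrite /J.
    rewrite phiD phiZ ReD Re_realM sqr_rnormD rnormZ rnormC dotC dotZl.
    rewrite Re_conjC Re_realM exprMn real_normK ?num_real// /b {b}.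
    move: (rnorm t) (rnorm x) (complex.Re (dot t x)) (complex.Re (phi x))
      (complex.Re (phi t)) => *; lra.
  have [t0|t0] := eqVneq t 0.
    by rewrite /b t0 phi0 linear0l subrr normr0 mulr_ge0 ?rnorm_ge0// ltW.
  have N0 : 0 < rnorm t by rewrite lt_def rnorm_eq0 t0 rnorm_ge0.
  rewrite -(@ler_pXn2r _ 2)// ?nnegrE ?mulr_ge0 ?rnorm_ge0 ?(ltW d0)//.
  rewrite real_normK ?num_real// exprMn -subr_ge0.
  (* The value of c that minimises the quadratic is - b / |t|^2. *)
  have -> : d ^+ 2 * rnorm t ^+ 2 - b ^+ 2 = rnorm t ^+ 2 *
      (d ^+ 2 + 2 * (- b / rnorm t ^+ 2) * b +
        (- b / rnorm t ^+ 2) ^+ 2 * rnorm t ^+ 2) by field; rewrite gt_eqF.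
  by rewrite mulr_ge0// sqr_ge0.
have /choice[s hs] (n : nat) : exists x, J x <= m + (n.+1%:R^-1) ^+ 2.
  by apply: m_approx; rewrite exprn_gt0 ?invr_gt0.
have hs' n k : (n <= k)%N -> J (s k) <= m + (n.+1%:R^-1) ^+ 2.
  move=> nk; rewrite (le_trans (hs k))// lerD2l ler_pXn2r ?nnegrE ?invr_ge0//.
  by rewrite lef_pV2 ?posrE// ler_nat.
have [e e0|w hw] := complete_seq (u := s).
  have [n ne] := harmonic_small (divr_gt0 e0 (ltr0Sn R 1)).
  exists n => k nk.
  apply: le_lt_trans (near_minimisers_close _ _ _ _ (hs n) (hs' _ _ nk)) _ => //.
  by rewrite mulrC -ltr_pdivlMr.
have Rew t : complex.Re (phi t) = complex.Re (dot t w).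
  apply/esym/(@complexI R)/eqP; rewrite -subr_eq0 -rmorphB/=; apply/eqP.
  apply: (@eq0_small_multiple _ _ _ (2 * rnorm t)) => e e0; rewrite rnormC.
  have [n1 h1] := hw e e0; have [n2 h2] := harmonic_small e0.
  have {}h1 := h1 _ (leq_maxl n1 n2).
  have /(variation _ t _ e0) : J (s (maxn n1 n2)) <= m + e ^+ 2.
    rewrite (le_trans (hs' _ _ (leq_maxr n1 n2)))// lerD2l.
    by rewrite ler_pXn2r ?nnegrE ?invr_ge0 ?(ltW h2) ?(ltW e0).
  set x := s _ in h1 *.
  have : `|complex.Re (dot t (w - x))| <= e * rnorm t.
    rewrite ler_norml; apply/andP; split.
      rewrite lerNl -ReN -linearNr/=.
      rewrite (le_trans (ler_Re_rnorm _))// (le_trans (dot_CauchySchwarz _ _))//.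
      by rewrite rnormN mulrC ler_wpM2r ?rnorm_ge0 ?ltW.
    rewrite (le_trans (ler_Re_rnorm _))// (le_trans (dot_CauchySchwarz _ _))//.
    by rewrite mulrC ler_wpM2r ?rnorm_ge0 ?ltW.
  rewrite linearBr/= ReD ReN !ler_norml => /andP[? ?] /andP[? ?].
  apply/andP; split; lra.
exists w => x; apply/eqP; rewrite eq_complex Rew eqxx/=.
have := Rew ('i%C *: x); rewrite phiZ dotZl.
rewrite [_ * phi x]mulrC [_ * dot _ _]mulrC !ReiNIm.
by move/oppr_inj->.
Qed.

Lemma bounded_adjoint (T : {linear X -> X}) :
    (exists M : R[i], forall x, `|T x| <= M * `|x|) ->
  exists T' : X -> X, forall x y, dot (T x) y = dot x (T' y).
Proof.
case=> M hM.
have bT x : rnorm (T x) <= rnorm M * rnorm x.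
  have := hM x; have [->|x0] := eqVneq x 0.
    by rewrite linear0 !rnorm0 mulr0.
  move=> h; rewrite -lecR rmorphM/= !rnormE ger0_norm//.
  by rewrite -(@pmulr_lge0 _ `|x|) ?normr_gt0// (le_trans _ h).
suff /choice[T' hT'] : forall y, exists z, forall x, dot (T x) y = dot x z.
  by exists T' => x y; exact: hT'.
move=> y; apply: (@Riesz (fun x => dot (T x) y) (rnorm M * rnorm y)).
  by move=> a u v; rewrite linearP linearPl.
move=> x; rewrite (le_trans (dot_CauchySchwarz _ _))// mulrAC.
by rewrite ler_wpM2r ?rnorm_ge0.
Qed.

(** Gliding hump. If [W] is unbounded, choose [w n] in [W] with [|w n| > n 3^n],
and [s (n+1)] at distance at most [3^-n] from [s n], in the direction of
[+ w n] or [- w n], so that [|<s (n+1), w n>| >= 3^-n |w n|]. The later steps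
move the sequence by at most [3^-n / 2] in total, so they cannot undo this, and
[|<x, w n>|] is unbounded for the limit [x]. *)
Lemma weakly_bounded (W : set X) :
    (forall x, exists K : R, forall w, W w -> rnorm (dot x w) <= K) ->
  exists M : R, forall w, W w -> rnorm w <= M.
Proof.
move=> wb; apply: contrapT => /forallNP unb.
have /choice[g hg] (M : R) : exists w, W w /\ M < rnorm w.
  have /existsNP[w /not_implyP[Ww /negP]] := unb M; rewrite -ltNge.
  by exists w.
pose r (n : nat) : R := 3^-1 ^+ n.
have r0 n : 0 < r n by rewrite exprn_gt0.
pose w n := g (n%:R / r n).
(* One of the two signs works, as < s + t, w n > - < s - t, w n > has norm
   2 r n |w n|. *)
have step n s : exists s', rnorm (s' - s) <= r n /\
    r n * rnorm (w n) <= rnorm (dot s' (w n)).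
  have [z|w0] := eqVneq (w n) 0.
    exists s; rewrite z linear0r subrr !rnorm0 mulr0; split => //.
    exact: ltW.
  have N0 : 0 < rnorm (w n) by rewrite lt_def rnorm_eq0 w0 rnorm_ge0.
  pose t := (r n / rnorm (w n))%:C%C *: w n.
  have Nt : rnorm t = r n.
    by rewrite rnormZ rnormC ger0_norm ?divr_ge0 ?ltW// divfK ?gt_eqF.
  have dt : rnorm (dot t (w n)) = r n * rnorm (w n).
    rewrite dotZl dot_norm -rnormE -rmorphXn -rmorphM/= rnormC ger0_norm.
      by field; rewrite gt_eqF.
    by rewrite mulr_ge0 ?divr_ge0 ?sqr_ge0 ?ltW.
  case: (leP (r n * rnorm (w n)) (rnorm (dot (s + t) (w n)))) => [h|h].
    by exists (s + t); rewrite addrAC subrr add0r Nt.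
  exists (s - t); rewrite addrAC subrr add0r rnormN Nt; split => //.
  have : rnorm (dot t (w n) + dot t (w n)) <=
      rnorm (dot (s + t) (w n)) + rnorm (dot (s - t) (w n)).
    rewrite -[rnorm (dot (s - t) _)]rnormN (le_trans _ (ler_rnormD _ _))//.
    by rewrite linearDl/= linearBl/= le_eqVlt; apply/predU1P; left;
       congr rnorm; ring.
  rewrite -mulr2n -mulr_natl rnormM dt.
  have -> : rnorm (2%:R : R[i]) = 2.
    by rewrite -(rmorph_nat (real_complex R)) rnormC ger0_norm.
  lra.
have /choice[f hf] (p : nat * X) := step p.1 p.2.
pose fix s n := if n is k.+1 then f (k, s k) else 0.
have s_step n : rnorm (s n.+1 - s n) <= r n by have [] := hf (n, s n).
have s_dot n : r n * rnorm (w n) <= rnorm (dot (s n.+1) (w n)).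
  by have [] := hf (n, s n).
have tail n k : rnorm (s n - s (n + k)%N) <= 3 / 2 * (r n - r (n + k)%N).
  elim: k => [|k IH]; first by rewrite addn0 !subrr rnorm0 mulr0.
  rewrite (le_trans (ler_rdistD _ (s (n + k)%N) _))// addnS rdistC addrC.
  have rS : r (n + k).+1 = 3^-1 * r (n + k)%N by rewrite /r exprS.
  have := s_step (n + k)%N; rewrite rS.
  rewrite rdistC [X in _ + X <= _]rdistC in IH *; lra.
have tail' n k : (n <= k)%N -> rnorm (s n - s k) <= 3 / 2 * r n.
  move=> /subnKC <-; rewrite (le_trans (tail _ _))// ler_pM2l//.
  by have := r0 (n + (k - n))%N; lra.
have r_small e : 0 < e -> exists n, r n < e.
  move=> /harmonic_small[n ne]; exists n; rewrite (le_lt_trans _ ne)//.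
  rewrite /r exprVn lef_pV2 ?posrE ?exprn_gt0// -natrX ler_nat.
  exact: ltn_expl.
have [e e0|x hx] := complete_seq (u := s).
  have [n ne] := r_small _ (divr_gt0 e0 (ltr0Sn R 1)).
  exists n => k nk; apply: le_lt_trans (tail' _ _ nk) _; lra.
(* The bound 1/2 r n for the limit, weakened to 3/4 r n to absorb the distance
   from x to a late term. *)
have x_tail n : rnorm (x - s n.+1) <= 3 / 4 * r n.
  have [k hk] := hx _ (divr_gt0 (r0 n) (ltr0Sn R 3)).
  rewrite (le_trans (ler_rdistD _ (s (maxn k n.+1)) _))//.
  have := hk _ (leq_maxl k n.+1); have := tail' _ _ (leq_maxr k n.+1).
  have rS : r n.+1 = 3^-1 * r n by rewrite /r exprS.
  rewrite (rdistC (s n.+1)) rS; lra.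
have [K hK] := wb x.
pose n := (Num.truncn (4 * K)).+1.
have Kn : 4 * K < n%:R by exact: truncnS_gt.
have [Ww Nw] : W (w n) /\ n%:R / r n < rnorm (w n) := hg _.
have := hK _ Ww; apply/negP; rewrite -ltNge.
have : rnorm (dot (s n.+1) (w n)) <=
    rnorm (dot x (w n)) + rnorm (dot (s n.+1 - x) (w n)).
  by rewrite -{1}(subrK x (s n.+1)) linearDl/= addrC ler_rnormD.
have : rnorm (dot (s n.+1 - x) (w n)) <= 3 / 4 * r n * rnorm (w n).
  by rewrite (le_trans (dot_CauchySchwarz _ _))// ler_wpM2r ?rnorm_ge0// rdistC.
have := s_dot n; move: Nw; rewrite ltr_pdivrMr// [rnorm (w n) * _]mulrC; lra.
Qed.

(** The images under the formal adjoint of the unit ball of its domain form a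
weakly bounded set, as [|<x, w>| = |<F x, u>| <= |F x|]. So the formal
adjoint is bounded, and extends from its dense domain by completeness. *)
Lemma Hellinger_Toeplitz (F : X -> X) :
    dense [set u | exists w, forall x, dot (F x) u = dot x w] ->
  exists G : X -> X, forall x u, dot (F x) u = dot x (G u).
Proof.
move=> dD; pose pair u w := forall x, dot (F x) u = dot x w.
have pairB u w u' w' : pair u w -> pair u' w' -> pair (u - u') (w - w').
  by move=> h h' x; rewrite !linearBr/= h h'.
have [x|M hM] := @weakly_bounded [set w | exists2 u, rnorm u <= 1 & pair u w].
  exists (rnorm (F x)) => w [u u1 uw]; rewrite -uw.
  by rewrite (le_trans (dot_CauchySchwarz _ _))// ler_piMr ?rnorm_ge0.
have bpair u w : pair u w -> rnorm w <= M * rnorm u.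
  move=> uw; have [u0|u0] := eqVneq u 0.
    suff -> : w = 0 by rewrite u0 !rnorm0 mulr0.
    by apply: dot_eq => x; rewrite -uw u0 !linear0r.
  have N0 : 0 < rnorm u by rewrite lt_def rnorm_eq0 u0 rnorm_ge0.
  have Na : rnorm ((rnorm u)^-1%:C%C : R[i]) = (rnorm u)^-1.
    by rewrite rnormC ger0_norm ?invr_ge0 ?rnorm_ge0.
  rewrite -ler_pdivrMr// mulrC -Na -rnormZ; apply: hM.
  exists ((rnorm u)^-1%:C%C *: u); first by rewrite rnormZ Na mulVf ?gt_eqF.
  by move=> x; rewrite !dotZr uw.
suff /choice[G hG] : forall u, exists w, pair u w.
  by exists G => x u; exact: hG.
move=> u.
have /choice[p hp] (n : nat) : exists p : X * X,
    pair p.1 p.2 /\ rnorm (u - p.1) < n.+1%:R^-1.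
  have [v [w vw] uv] := dense_approx dD u (divr_gt0 ltr01 (ltr0Sn R n)).
  by exists (v, w); split => //=; rewrite -div1r.
have near_u n k : (n <= k)%N -> rnorm (u - (p k).1) < n.+1%:R^-1.
  move=> nk; have [_ /lt_le_trans->//] := hp k.
  by rewrite lef_pV2 ?posrE// ler_nat.
have [e e0|w hw] := complete_seq (u := fun n => (p n).2).
  have M1 : 0 < 2 * (`|M| + 1) by have := normr_ge0 M; lra.
  have [n ne] := harmonic_small (divr_gt0 e0 M1).
  exists n => k nk; have [pn _] := hp n; have [pk _] := hp k.
  rewrite (le_lt_trans (bpair _ _ (pairB _ _ _ _ pn pk)))//.
  have := ler_rdistD (p n).1 u (p k).1; rewrite (rdistC _ u).
  have := near_u n n (leqnn n); have := near_u n k nk.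
  move: ne; set d := n.+1%:R^-1; rewrite ltr_pdivlMr//.
  set q := rnorm ((p n).1 - _) => de q1 q2 q3.
  have : M * q <= (`|M| + 1) * q.
    rewrite ler_wpM2r ?rnorm_ge0//; have := ler_norm M; lra.
  have : (`|M| + 1) * q <= (`|M| + 1) * (2 * d).
    rewrite ler_wpM2l//; have := normr_ge0 M; lra.
  lra.
exists w => x; apply/eqP; rewrite -subr_eq0; apply/eqP.
apply: (@eq0_small_multiple _ _ _ (rnorm (F x) + rnorm x)) => e e0.
have [n1 h1] := hw e e0; have [n2 h2] := harmonic_small e0.
have {}h1 := h1 _ (leq_maxl n1 n2).
have {}h2 := lt_trans (near_u _ _ (leq_maxr n1 n2)) h2.
have [pn _] := hp (maxn n1 n2); move: (p _) pn h1 h2 => [v z]/= vz h1 h2.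
have -> : dot (F x) u - dot x w = dot (F x) (u - v) - dot x (w - z).
  by rewrite !linearBr/= vz; ring.
rewrite (le_trans (ler_rnormD _ _))// rnormN mulrDr lerD//.
  by rewrite (le_trans (dot_CauchySchwarz _ _))// mulrC ler_wpM2r ?rnorm_ge0 ?ltW.
by rewrite (le_trans (dot_CauchySchwarz _ _))// mulrC ler_wpM2r ?rnorm_ge0 ?ltW.
Qed.

End Hilbert.

(** * Graphs of operators *)

Section OperatorGraphs.
Context {K : pzRingType} {U : lmodType K}.
Implicit Types (A B C T : set (U * U)) (S : U -> U) (l : K).

(** The Schur complement [T + l + C S B], the map [S] standing for the resolvent. *)
Definition schur_op T B C S l : set (U * U) :=
  (T + l%:I + C * total_op S * B)%OP.

Lemma schur_opP T B C S l y z :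
  schur_op T B C S l (y, z) <->
  exists a b c, [/\ T (y, a), B (y, b), C (S b, c) & z = a + l *: y + c].
Proof.
split.
  move=> [r [c [[a [t [/= Ta tE ->]]] [b Bb [x xE Cc]] ->]]].
  rewrite /scalar_op /total_op/= in tE xE *; rewrite {}tE; rewrite {}xE in Cc.
  by exists a, b, c.
move=> [a [b [c [Ta Bb Cc ->]]]]; exists (a + l *: y), c; split=> //=.
  by exists a, (l *: y).
by exists b => //; exists (S b).
Qed.

(** The resolvent equation without subtraction or inversion of graphs: the form
[s + l x] makes the rewriting of [A (S s, _)] direct. *)
Lemma inv_shift_opP A S l : ((A - l%:I)^-1)%OP = total_op S <->
  forall s x, A (x, s + l *: x) <-> x = S s.
Proof.
have E s x : ((A - l%:I)^-1)%OP (s, x) <-> A (x, s + l *: x).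
  split=> [[y [z [/= Ay lz ->]]]|Ax].
    by rewrite -[l *: x]lz addrK.
  by exists (s + l *: x), (- (l *: x)); split; rewrite //= ?addrK// /opp_op/= opprK.
split=> [h s x|h]; first by rewrite -E h.
by apply/seteqP; split=> -[s x]; rewrite E h.
Qed.

Lemma symplectic_mulP A B C D x y p q :
  (symplectic_J * block_op A B C D)%OP ((x, y), (p, q)) <->
  exists a b c d, [/\ A (x, a), B (y, b), C (x, c), D (y, d) &
    p = c + d /\ q = - (a + b)].
Proof.
split.
  move=> [_ [a [b [c [d [/= Aa Bb Cc Dd ->]]]]]].
  move=> [t1 [t2 [z [t3 [/= t1E t2E zE t3E [-> ->]]]]]].
  rewrite /opp_op /scalar_op /total_op/= in t1E t2E zE t3E *.
  rewrite {}t1E {}t2E {}t3E.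
  exists a, b, c, d; split=> //; rewrite !scale0r scale1r add0r addr0; split=> //.
  by rewrite -[z]opprK zE scale1r.
move=> [a [b [c [d [Aa Bb Cc Dd [-> ->]]]]]].
exists (a + b, c + d); first by exists a, b, c, d.
exists 0, (c + d), (- (a + b)), 0.
rewrite /opp_op /scalar_op /total_op/= !scale0r !scale1r opprK add0r addr0.
by split.
Qed.

End OperatorGraphs.

(** * Adjoints of Schur complements and of JH *)

Section Adjoints.
Context {R : realType} {X : completeNormedModType R[i]}.
Variable dot : {dot X for Num.conj}.
Hypothesis dot_norm : forall x : X, dot x x = `|x| ^+ 2.
Implicit Types (A B C T : set (X * X)) (S : X -> X) (l : R[i]).

Lemma adjoint_functional T u w w' : dense T.`1 ->
  adjoint dot T (u, w) -> adjoint dot T (u, w') -> w = w'.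
Proof.
move=> dT h h'; apply: (dense_dot_eq dot_norm dT) => x [y Ty].
by rewrite -(h _ _ Ty) -(h' _ _ Ty).
Qed.

Lemma adjoint_dot T T' x a y b : T' = adjoint dot T ->
  T (x, a) -> T' (y, b) -> dot a y = dot x b.
Proof. by move=> -> Ta; apply. Qed.

(** As [S] is onto [D(A)], the relation [<a, y> = <x, z + l^* y>] over the graph
of [A] says that [<s, y> = <S s, z>] for all [s]. *)
Lemma adjoint_resolvent A S S' l :
    (forall s x, A (x, s + l *: x) <-> x = S s) ->
    (forall s y, dot (S s) y = dot s (S' y)) ->
  forall z y, adjoint dot A (y, z + l^* *: y) <-> y = S' z.
Proof.
move=> resA SS' z y; split=> [h|-> x a].
  apply: (dot_eq dot_norm) => s; rewrite -SS'.
  have := h _ _ (proj2 (resA s _) erefl); rewrite /= linearDl linearDr/=.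
  by rewrite dotZl dotZr conjCK => /addIr.
move=> Axa /=; have xE : x = S (a - l *: x) by apply/resA; rewrite subrK.
rewrite linearDr/= dotZr conjCK.
have : dot x z = dot (a - l *: x) (S' z) by rewrite {1}xE SS'.
by rewrite linearBl/= dotZl => ->; rewrite subrK.
Qed.

(** [A^** - l] extends [A - l], which is onto; and it is injective, as [A^* - l^*]
is onto. No proper extension of a surjective map is injective. *)
Lemma double_adjoint A S S' l :
    (forall s x, A (x, s + l *: x) <-> x = S s) ->
    (forall s y, dot (S s) y = dot s (S' y)) ->
  A = adjoint dot (adjoint dot A).
Proof.
move=> resA SS'; have resA' := adjoint_resolvent resA SS'.
apply/seteqP; split=> -[u w].
  move=> Auw y a' /(_ _ _ Auw)/= h.
  by rewrite dotC -h -dotC.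
move=> h; suff /resA : u = S (w - l *: u) by rewrite subrK.
apply: (dot_eq dot_norm) => s.
have S'S y t : dot (S' y) t = dot y (S t) by rewrite dotC -SS' -dotC.
rewrite -S'S.
have := h _ _ (proj2 (resA' s _) erefl); rewrite /= linearDl/= dotZl.
by rewrite linearBr/= dotZr => <-; rewrite addrK.
Qed.

(** The hypotheses of the theorem for a fixed [l], in a form that is invariant
under the exchange of [A, B, S, l] with [A', C, S', l^*]; see
[hamiltonian_resolvent_sym]. *)
Record hamiltonian_resolvent A A' B C S S' l : Prop := HamiltonianResolvent {
  adjA' : A' = adjoint dot A;
  adjA : A = adjoint dot A';
  adjB : B = adjoint dot B;
  adjC : C = adjoint dot C;
  domC : A.`1 `<=` C.`1;
  domB : A'.`1 `<=` B.`1;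
  denseA : dense A.`1;
  denseA' : dense A'.`1;
  denseB : dense B.`1;
  denseC : dense C.`1;
  resA : forall s x, A (x, s + l *: x) <-> x = S s;
  resA' : forall s y, A' (y, s + l^* *: y) <-> y = S' s;
  adjS : forall s y, dot (S s) y = dot s (S' y) }.

Lemma hamiltonian_resolvent_sym A A' B C S S' l :
  hamiltonian_resolvent A A' B C S S' l ->
  hamiltonian_resolvent A' A C B S' S l^*.
Proof.
case=> *; split=> //; first by rewrite conjCK.
by move=> s y; rewrite dotC; apply/esym; rewrite dotC; congr (_^*).
Qed.

(** The two premises together say that [(u, v)] is in the domain of the adjoint of
[JH], with image [(p, - q)]: test vectors [(x, 0)] and [(0, y)] suffice. So the
property is [D((JH)^* ) <= D(A) * D(A')]. *)
Definition adjoint_domain_inclusion A A' B C : Prop :=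
  forall u v p q,
    (forall x a c, A (x, a) -> C (x, c) -> dot c u - dot a v = dot x p) ->
    (forall y a' b, A' (y, a') -> B (y, b) -> dot a' u + dot b v = dot y q) ->
  A.`1 u /\ A'.`1 v.

Lemma adjoint_domain_inclusion_sym A A' B C : A' = adjoint dot A ->
  adjoint_domain_inclusion A A' B C -> adjoint_domain_inclusion A' A C B.
Proof.
move=> A'E h u v p q h1 h2; have [|y a' b A'a Bb|Av [w]] := h v (- u) q (- p).
- by move=> x a c Aa Cc; rewrite linearNr/= opprK addrC (h2 x a c).
- by rewrite !linearNr/= -(h1 y a' b)// opprB.
- rewrite A'E => Nu; split=> //; exists (- w) => x a Aa /=.
  by rewrite linearNr/= -(Nu _ _ Aa) linearNr/= opprK.
Qed.

(** In both directions [(u, v)] in [D((JH)^* )] is linked to [u] in [D(S1^* )] by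
testing on [x = S s], as explained above. *)
Lemma schur_adjointP A A' B C S S' l :
    hamiltonian_resolvent A A' B C S S' l ->
  schur_op A C B S' l^* = adjoint dot (schur_op A' B C S l) <->
  adjoint_domain_inclusion A A' B C.
Proof.
case=> A'E AE BE CE dC dB denA denA' denB denC rA rA' SS'.
have A_S s : A (S s, s + l *: S s) by apply/rA.
have A'_S' s : A' (S' s, s + l^* *: S' s) by apply/rA'.
have AA' y a' x a := @adjoint_dot A' A y a' x a AE.
have BB y b y' b' := @adjoint_dot B B y b y' b' BE.
have CC x c x' c' := @adjoint_dot C C x c x' c' CE.
split=> [E u v p q hA hA'|Q].
  (* S1^* u = q + l^* u + B S' (l^* v + p) *)
  have [b2 Bb2] := dB (S' (l^* *: v + p)) (ex_intro _ _ (A'_S' _)).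
  have Au : A.`1 u.
    suff : schur_op A C B S' l^* (u, q + l^* *: u + b2).
      by case/schur_opP => a [c [b [Aa _ _ _]]]; exists a.
    rewrite E => y z /schur_opP[a' [b [c [A'a Bb Cc ->]]]] /=.
    rewrite !linearDl/= !linearDr/= -(hA' _ _ _ A'a Bb) dotZl dotZr conjCK.
    have : dot (S b) (l^* *: v + p) = dot y b2.
      by rewrite SS' (BB _ _ _ _ Bb Bb2).
    rewrite linearDr/= -(hA _ _ _ (A_S b) Cc) linearDl/= dotZl dotZr conjCK.
    by move=> <-; ring.
  split=> //; have [cu Cu] := dC _ Au.
  exists (cu - p); rewrite A'E => x a Aa /=.
  have [c Cc] := dC x (ex_intro _ _ Aa).
  rewrite linearBr/= -(hA _ _ _ Aa Cc) (CC _ _ _ _ Cc Cu); ring.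
have sub : schur_op A C B S' l^* `<=` adjoint dot (schur_op A' B C S l).
  move=> [x z] /schur_opP[a [c [b1 [Aa Cc Bb1 ->]]]] y z' /schur_opP.
  move=> [a' [b [c1 [A'a Bb Cc1 ->]]]] /=.
  rewrite !linearDl/= !linearDr/= dotZl dotZr conjCK (AA' _ _ _ _ A'a Aa).
  by rewrite (CC _ _ _ _ Cc1 Cc) SS' (BB _ _ _ _ Bb Bb1).
apply/seteqP; split=> // -[u w] uw.
have /choice[F hF] s : exists c, C (S s, c) by exact: dC (ex_intro _ _ (A_S s)).
(* C S is everywhere defined, and S' C is a formal adjoint on D(C). *)
have [G hG] : exists G : X -> X, forall s t, dot (F s) t = dot s (G t).
  apply: (Hellinger_Toeplitz dot_norm).
  apply: (@subset_dense _ C.`1); last exact: denC.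
  move=> t [ct Ct]; exists (S' ct) => s.
  by rewrite (CC _ _ _ _ (hF s) Ct) SS'.
have CF s c : C (S s, c) -> c = F s.
  move=> Cs; apply: (adjoint_functional denC (u := S s)); rewrite -CE //.
have S1F y a' b : A' (y, a') -> B (y, b) ->
    schur_op A' B C S l (y, a' + l *: y + F b).
  by move=> A'a Bb; apply/schur_opP; exists a', b, (F b).
(* With v = (C S)^* u, the pair (u, v) is in the domain of the adjoint of JH. *)
have [|y a' b A'a Bb|[a Aa] _] := Q u (G u) (- (l^* *: G u)) (w - l^* *: u).
- move=> x a c Aa Cc.
  have xE : x = S (a - l *: x) by apply/rA; rewrite subrK.
  rewrite xE in Cc; rewrite (CF _ _ Cc) hG linearBl/= dotZl linearNr/= dotZr conjCK.
  by ring.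
- have := uw _ _ (S1F _ _ _ A'a Bb); rewrite /= !linearDl/= linearBr/= => <-.
  by rewrite dotZl dotZr conjCK hG; ring.
have [c Cc] := dC u (ex_intro _ _ Aa).
have [b Bb] := dB (S' c) (ex_intro _ _ (A'_S' c)).
have S2u : schur_op A C B S' l^* (u, a + l^* *: u + b).
  by apply/schur_opP; exists a, c, b.
suff -> : w = a + l^* *: u + b by [].
apply: (@adjoint_functional (schur_op A' B C S l) u) => //; last exact: sub.
apply: subset_dense denA' => y [a' A'a].
have [b' Bb'] := dB y (ex_intro _ _ A'a).
by exists (a' + l *: y + F b'); exact: S1F.
Qed.

(** [JH] is symmetric, so self-adjointness is a matter of domains: two values of
the adjoint at a point of [D(JH)] agree, as [D(A)] and [D(A')] are dense. *)
Lemma symplectic_self_adjointP A A' B C S S' l :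
    hamiltonian_resolvent A A' B C S S' l ->
  symplectic_self_adjoint dot (hamiltonian_matrix dot A B C) <->
  adjoint_domain_inclusion A A' B C.
Proof.
case=> A'E AE BE CE dC dB denA denA' _ _ _ _ _.
have AA' y a' x a := @adjoint_dot A' A y a' x a AE.
have A'A x a y a' := @adjoint_dot A A' x a y a' A'E.
have BB y b y' b' := @adjoint_dot B B y b y' b' BE.
have CC x c x' c' := @adjoint_dot C C x c x' c' CE.
rewrite /symplectic_self_adjoint; set JH := (symplectic_J * _)%OP.
have JHP x y p q : JH ((x, y), (p, q)) <-> exists a b c a',
    [/\ A (x, a), B (y, b), C (x, c), A' (y, a') & p = c - a' /\ q = - (a + b)].
  split=> [/symplectic_mulP[a [b [c [d [Aa Bb Cc A'd [-> ->]]]]]]|].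
    by exists a, b, c, (- d); rewrite opprK A'E.
  move=> [a [b [c [a' [Aa Bb Cc A'a [-> ->]]]]]]; apply/symplectic_mulP.
  by exists a, b, c, (- a'); split=> //; rewrite /opp_op/= opprK -A'E.
have JH_sub : JH `<=` adjoint (pair_dot dot) JH.
  move=> [[u v] [p q]] /JHP[a [b [c [a' [Aa Bb Cc A'a [-> ->]]]]]].
  move=> [x y] [p0 q0] /JHP[a0 [b0 [c0 [a0' [Aa0 Bb0 Cc0 A'a0 [-> ->]]]]]].
  rewrite /= /pair_dot /= !dot_addE (CC _ _ _ _ Cc0 Cc) (BB _ _ _ _ Bb0 Bb).
  by rewrite (AA' _ _ _ _ A'a0 Aa) (A'A _ _ _ _ Aa0 A'a); ring.
split=> [E u v p q hA hA'|Q].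
  suff : JH ((u, v), (p, - q)).
    by case/JHP=> a [b [c [a' [Aa _ _ A'a _]]]]; split; [exists a|exists a'].
  rewrite E => -[x y] [p0 q0] /JHP[a [b [c [a' [Aa Bb Cc A'a [-> ->]]]]]].
  rewrite /= /pair_dot /= linearBl/= linearNl/= linearDl/= linearNr/=.
  by rewrite -(hA _ _ _ Aa Cc) -(hA' _ _ _ A'a Bb); ring.
have A00 : A (0, 0) by rewrite AE => x a _; rewrite /= !linear0r.
have A'00 : A' (0, 0) by rewrite A'E => x a _; rewrite /= !linear0r.
have B00 : B (0, 0) by rewrite BE => x a _; rewrite /= !linear0r.
have C00 : C (0, 0) by rewrite CE => x a _; rewrite /= !linear0r.
apply/seteqP; split=> // -[[u v] [p q]] h.
have hA x a c : A (x, a) -> C (x, c) -> dot c u - dot a v = dot x p.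
  move=> Aa Cc; have : JH ((x, 0), (c - 0, - (a + 0))).
    by apply/JHP; exists a, 0, c, 0.
  by move/h; rewrite /= /pair_dot /= subr0 addr0 linear0l addr0 linearNl.
have hA' y a' b : A' (y, a') -> B (y, b) -> dot a' u + dot b v = - dot y q.
  move=> A'a Bb; have : JH ((0, y), (0 - a', - (0 + b))).
    by apply/JHP; exists 0, b, 0, a'.
  move/h; rewrite /= /pair_dot /= sub0r add0r linear0l add0r !linearNl/= => <-.
  by rewrite opprD !opprK.
have [y a' b A'a Bb|[a Aa] [a' A'a]] := Q u v p (- q) hA.
  by rewrite dotNr (hA' y a' b).
have [c Cc] := dC u (ex_intro _ _ Aa); have [b Bb] := dB v (ex_intro _ _ A'a).
apply/JHP; exists a, b, c, a'; split=> //; split.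
  apply: (dense_dot_eq dot_norm denA) => x [a0 Aa0].
  have [c0 Cc0] := dC x (ex_intro _ _ Aa0).
  rewrite -(hA _ _ _ Aa0 Cc0) linearBr/= (CC _ _ _ _ Cc0 Cc).
  by rewrite (A'A _ _ _ _ Aa0 A'a).
apply: (dense_dot_eq dot_norm denA') => y [a0 A'a0].
have [b0 Bb0] := dB y (ex_intro _ _ A'a0).
apply: oppr_inj; rewrite -(hA' _ _ _ A'a0 Bb0) linearNr/= opprK linearDr/=.
by rewrite (AA' _ _ _ _ A'a0 Aa) (BB _ _ _ _ Bb0 Bb).
Qed.

End Adjoints.

(** * The equivalence *)

Theorem theorem3p1 (R : realType) (X : completeNormedModType R[i])
    (dot : {dot X for Num.conj}) (dot_norm : forall x : X, dot x x = `|x| ^+ 2)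
    (A B C : set (X * X)) (hH : is_hamiltonian dot A B C)
    (domH : (hamiltonian_matrix dot A B C).`1 = A.`1 `*` (adjoint dot A).`1)
    (rhoA : resolvent_set A !=set0) :
  let A' := adjoint dot A in
  let S1 (l : R[i]) := (A' + l%:I + C * (A - l%:I)^-1 * B)%OP in
  let S2 (l : R[i]) := (A + l^*%:I + B * (A' - l^*%:I)^-1 * C)%OP in
  [<-> symplectic_self_adjoint dot (hamiltonian_matrix dot A B C);
       exists2 l, resolvent_set A l & S1 l = adjoint dot (S2 l);
       forall l, resolvent_set A l -> S1 l = adjoint dot (S2 l);
       exists2 l, resolvent_set A l & S2 l = adjoint dot (S1 l);
       forall l, resolvent_set A l -> S2 l = adjoint dot (S1 l)].
Proof.
move=> A' S1 S2.
have [[[_ _ denA] [_ _ denB] [_ _ denC]] BE CE denH] := hH.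
have A'00 : A' (0, 0) by move=> x a _; rewrite /= !linear0r.
have A00 : A (0, 0) by case: hH => -[[[]]].
have domC : A.`1 `<=` C.`1.
  move=> x Ax; have : (A.`1 `*` A'.`1) (x, 0) by split=> //; exists 0.
  by rewrite -domH => -[w [a [b [c [d [_ _ Cc _ _]]]]]]; exists c.
have domB : A'.`1 `<=` B.`1.
  move=> y A'y; have : (A.`1 `*` A'.`1) (0, y) by split=> //; exists 0.
  by rewrite -domH => -[w [a [b [c [d [_ Bb _ _ _]]]]]]; exists b.
have denA' : dense A'.`1.
  move=> O [x Ox] oO; move: denH; rewrite domH.
  case/(_ (snd @^-1` O)) => [||[y z] [/= Oz [_ A'z]]].
  - by exists (0, x).
  - by apply: open_comp => // z _; exact: cvg_snd.
  - by exists z.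
have key l : resolvent_set A l ->
    (S1 l = adjoint dot (S2 l) <->
       symplectic_self_adjoint dot (hamiltonian_matrix dot A B C)) /\
    (S2 l = adjoint dot (S1 l) <->
       symplectic_self_adjoint dot (hamiltonian_matrix dot A B C)).
  case=> S bS SE; have [S' SS'] := bounded_adjoint dot_norm bS.
  have rA := (inv_shift_opP _ _ _).1 SE.
  have rA' := adjoint_resolvent dot_norm rA SS'.
  have hr : hamiltonian_resolvent dot A A' B C S S' l.
    by split=> //; exact: double_adjoint rA SS'.
  have -> : S1 l = schur_op A' B C S l by rewrite /S1 SE.
  have -> : S2 l = schur_op A C B S' l^*.
    by rewrite /S2 ((inv_shift_opP _ _ _).2 rA').
  have hr' := hamiltonian_resolvent_sym hr.
  have Psym : adjoint_domain_inclusion dot A A' B C <->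
      adjoint_domain_inclusion dot A' A C B.
    by split; apply: adjoint_domain_inclusion_sym; [|case: hr].
  have := schur_adjointP dot_norm hr'; rewrite conjCK => ->.
  rewrite (schur_adjointP dot_norm hr) (symplectic_self_adjointP dot_norm hr).
  by rewrite Psym.
have [l0 rl0] := rhoA.
tfae.
- by move=> h; exists l0 => //; apply/(key _ rl0).1.
- by move=> [l rl /(key _ rl).1 h] m rm; apply/(key _ rm).1.
- by move=> h; exists l0 => //; apply/(key _ rl0).2/(key _ rl0).1; exact: h.
- by move=> [l rl /(key _ rl).2 h] m rm; apply/(key _ rm).2.
- by move=> h; apply/(key _ rl0).2; exact: h.
Qed.
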